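(* Assume that $\mathcal{F}$ is compact and that $f_2(x,\xi)$ is continuous on $\mathcal{F}$. Let $\nu$ be a given probability measure supported on $\mathcal{F}$. Then the objective of the optimization problem $$\max_{p\in\mathbb{R}[x,\xi]}\ \int_{\mathcal{F}} p(x,\xi)\,d\nu\quad\text{s.t.}\quad F(x,y,\xi)-p(x,\xi)\in\mathscr{P}(K)$$ is bounded from above on its feasible region, and the optimal value of this problem equals $\int_{\mathcal{F}} f_2(x,\xi)\,d\nu$.
   Context: Let $x\in\mathbb{R}^{n_1}$, $y\in\mathbb{R}^{n_2}$, $\xi\in\mathbb{R}^{n_0}$, and let $\mathcal{I}_0,\mathcal{I}_1,\mathcal{I}_2$ be finite, possibly empty, index sets. The functions $g_{0,i}\in\mathbb{R}[\xi]$ ($i\in\mathcal{I}_0$), $g_{1,i}\in\mathbb{R}[x]$ ($i\in\mathcal{I}_1$), $g_{2,i}\in\mathbb{R}[x,y,\xi]$ ($i\in\mathcal{I}_2$) and $F\in\mathbb{R}[x,y,\xi]$ are real polynomials. Define $X=\{x: g_{1,i}(x)\ge 0\ \forall i\in\mathcal{I}_1\}$, $S=\{\xi: g_{0,i}(\xi)\ge0\ \forall i\in\mathcal{I}_0\}$, $Y(x,\xi)=\{y: g_{2,i}(x,y,\xi)\ge 0\ \forall i\in\mathcal{I}_2\}$, and the recourse function $f_2(x,\xi)=\inf_{y\in Y(x,\xi)}F(x,y,\xi)$. Let $\mathcal{F}=\{(x,\xi)\in X\times S: Y(x,\xi)\neq\emptyset\}$ and $K=\{(x,y,\xi):(x,\xi)\in\mathcal{F},\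 y\in Y(x,\xi)\}$. $\mathscr{P}(K)$ is the cone of polynomials in $\mathbb{R}[x,y,\xi]$ that are nonnegative on $K$. The optimal value of a maximization problem is the supremum of its objective over its feasible set (not necessarily attained). *)

(* Defs.v *)
From mathcomp Require Import all_boot all_order all_algebra.
From mathcomp Require Import all_classical all_reals all_analysis.
(* The notations of mpoly clash with those of mathcomp-analysis. *)
From mathcomp Require Import -(notations) mpoly.
Import Order.TTheory GRing.Theory Num.Theory.
Import numFieldNormedType.Exports.

Set Implicit Arguments.
Unset Strict Implicit.
Unset Printing Implicit Defensive.

Local Open Scope classical_set_scope.
Local Open Scope ring_scope.
Local Open Scope ereal_scope.

Definition evalp (R : realType) (n : nat) (p : mpoly n R) (v : 'rV[R]_n) : R :=
  meval (fun i => v 0%R i) p.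

Definition semialg (R : realType) (I : finType) (n : nat) (g : I -> mpoly n R) :
    set 'rV[R]_n :=
  [set v | forall i : I, (0 <= evalp (g i) v)%R].

(* The inclusion R[x, xi] -> R[x, y, xi]; the variables of R[x, y, xi] are
   ordered as x, then y, then xi. *)
Definition embed_xxi (R : realType) (n0 n1 n2 : nat) (p : mpoly (n1 + n0) R) :
    mpoly (n1 + n2 + n0) R :=
  comp_mpoly
    [tuple match fintype.split i with
           | inl j => mpolyX R (mnm1 (lshift n0 (lshift n2 j)))
           | inr k => mpolyX R (mnm1 (rshift (n1 + n2) k))
           end | i < n1 + n0]
    p.

Lemma evalp_embed_xxi (R : realType) (n0 n1 n2 : nat) (p : mpoly (n1 + n0) R)
    (x : 'rV[R]_n1) (y : 'rV[R]_n2) (xi : 'rV[R]_n0) :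
  evalp (embed_xxi n2 p) (row_mx (row_mx x y) xi) = evalp p (row_mx x xi).
Proof.
rewrite /evalp /embed_xxi comp_mpoly_meval; apply: meval_eq => i.
rewrite tnth_map tnth_ord_tuple; case: fintype.splitP => j ij; rewrite mevalXU.
- rewrite !row_mxEl; suff -> : i = lshift n0 j by rewrite row_mxEl.
  exact: val_inj.
- rewrite row_mxEr; suff -> : i = rshift n1 j by rewrite row_mxEr.
  exact: val_inj.
Qed.

Section TwoStage.
Variables (R : realType) (n0 n1 n2 : nat) (I0 I1 I2 : finType).
Variables (g0 : I0 -> mpoly n0 R) (g1 : I1 -> mpoly n1 R)
  (g2 : I2 -> mpoly (n1 + n2 + n0) R) (F : mpoly (n1 + n2 + n0) R).

Definition setX : set 'rV[R]_n1 := semialg g1.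

Definition setS : set 'rV[R]_n0 := semialg g0.

Definition setY (x : 'rV[R]_n1) (xi : 'rV[R]_n0) : set 'rV[R]_n2 :=
  [set y | semialg g2 (row_mx (row_mx x y) xi)].

(* Extended-real valued: +oo where setY is empty, -oo where F is unbounded
   below on setY. *)
Definition recourse (z : 'rV[R]_n1 * 'rV[R]_n0) : \bar R :=
  ereal_inf [set (evalp F (row_mx (row_mx z.1 y) z.2))%:E | y in setY z.1 z.2].

Definition feasF : set ('rV[R]_n1 * 'rV[R]_n0) :=
  [set z | [/\ setX z.1, setS z.2 & setY z.1 z.2 !=set0]].

Definition setK : set ('rV[R]_n1 * 'rV[R]_n2 * 'rV[R]_n0) :=
  [set w | feasF (w.1.1, w.2) /\ setY w.1.1 w.2 w.1.2].

End TwoStage.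

Definition nonneg_cone (R : realType) (n0 n1 n2 : nat)
    (K : set ('rV[R]_n1 * 'rV[R]_n2 * 'rV[R]_n0)) :
    set (mpoly (n1 + n2 + n0) R) :=
  [set q | forall w, K w -> (0 <= evalp q (row_mx (row_mx w.1.1 w.1.2) w.2))%R].

Definition borelT (R : realType) (n0 n1 : nat) :=
  g_sigma_algebraType (@open ('rV[R]_n1 * 'rV[R]_n0)%type).

Section Dual.
Variables (R : realType) (n0 n1 n2 : nat) (I0 I1 I2 : finType).
Variables (g0 : I0 -> mpoly n0 R) (g1 : I1 -> mpoly n1 R)
  (g2 : I2 -> mpoly (n1 + n2 + n0) R) (F : mpoly (n1 + n2 + n0) R).

Definition feasible : set (mpoly (n1 + n0) R) :=
  [set p | nonneg_cone (setK g0 g1 g2) (F - embed_xxi n2 p)%R].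

Definition objective (nu : probability (borelT R n0 n1) R)
    (p : mpoly (n1 + n0) R) : \bar R :=
  \int[nu]_(z in feasF g0 g1 g2) (evalp p (row_mx z.1 z.2))%:E.

End Dual.

(* Main.v *)
(** A polynomial p(x, xi) is feasible iff p <= f_2 pointwise on the feasible
    set, because f_2(x, xi) is the infimum of F(x, ., xi) over Y(x, xi).
    Monotonicity of the integral then bounds the objective by the integral of
    f_2. Conversely, Stone-Weierstrass on the compact feasible set yields a
    polynomial within e/2 of the continuous function f_2 - e/2; it is feasible,
    and its integral is at least that of f_2 minus e. *)

Require Import Defs.
From mathcomp Require Import all_boot all_order all_algebra.
From mathcomp Require Import all_classical all_reals all_analysis.
From mathcomp Require Import -(notations) mpoly.
From mathcomp Require Import ring lra.
Import Order.TTheory GRing.Theory Num.Theory.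
Import numFieldNormedType.Exports.

Set Implicit Arguments.
Unset Strict Implicit.
Unset Printing Implicit Defensive.

Local Open Scope classical_set_scope.
Local Open Scope ring_scope.

(** * Polynomial approximation of the absolute value *)

(* Started at 0, the recursion q <- q + (t^2 - q^2) / 2 increases to |t| on
   [-1, 1]; it is spelled with sums and products only, so that it preserves
   membership in a subalgebra. *)
Fixpoint abs_iter {R : realFieldType} (k : nat) (t : R) : R :=
  if k is k'.+1 then
    abs_iter k' t + 2^-1 * (t * t + (-1) * (abs_iter k' t * abs_iter k' t))
  else 0.

(** Each step multiplies the error [a - q] by [1 - (a + q) / 2], which is at most [1 - a / 2] since
    [q] is nonnegative. The third bound is the resulting decay [a / (1 + k * a / 2)] with its
    denominator cleared, a form that passes through the induction. *)
Lemma abs_iter_bounds {R : realFieldType} (k : nat) (t : R) : `|t| <= 1 ->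
  [/\ 0 <= abs_iter k t, abs_iter k t <= `|t| &
      (`|t| - abs_iter k t) * (1 + k%:R * `|t| / 2) <= `|t|].
Proof.
move=> t1; have t0 := normr_ge0 t.
have -> : abs_iter k t = abs_iter k `|t|.
  by elim: k => //= k ->; rewrite -(expr2 `|t|) real_normK ?num_real.
move: t0 t1; move: `|t| => a a0 a1.
elim: k => [|k [q0 qa IH]] /=.
  by split => //; rewrite mul0r mul0r subr0 addr0 mulr1.
set q := abs_iter k a in q0 qa IH *.
have E : a - (q + 2^-1 * (a * a + (-1) * (q * q))) =
    (a - q) * (1 - (a + q) / 2) by field.
split.
- nra.
- by rewrite -subr_ge0 E; nra.
- rewrite E; apply: le_trans IH; rewrite -mulrA ler_wpM2l ?subr_ge0 //.
  have k0 : 0 <= k%:R :> R by exact: ler0n.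
  rewrite -[k.+1%:R]natr1 -subr_ge0; move: (k%:R : R) k0 => c c0.
  rewrite [leRHS](_ : _ = q / 2 + (a + q) * (c + 1) * a / 4); last by field.
  by rewrite addr_ge0 ?divr_ge0 ?mulr_ge0 ?addr_ge0.
Qed.

(** Cancelling [|t|] in the third bound of [abs_iter_bounds] leaves a rate that is uniform in [t].
    At [t = 0], where nothing can be cancelled, the iterate is squeezed to 0. *)
Lemma abs_iter_error {R : realFieldType} (k : nat) (t : R) : `|t| <= 1 ->
  `|(`|t| - abs_iter k.+1 t)| <= 2 / k.+1%:R.
Proof.
move=> /(abs_iter_bounds k.+1)[]; set q := abs_iter _ _ => q0 qt H.
have c0 : 0 < k.+1%:R :> R by rewrite ltr0n.
rewrite ger0_norm ?subr_ge0//.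
move: (k.+1%:R : R) (`|t| : R) (normr_ge0 t) c0 q0 qt H => c a + c0 q0 qa.
(* The norm hides the field order of R from rewriting. *)
change (0 <= a -> (a - q) * (1 + c * a / 2) <= a -> a - q <= 2 / c).
rewrite ler_pdivlMr// le_eqVlt => /predU1P[a0 _|a0 H].
  by rewrite -a0 in qa *; nra.
rewrite -(ler_pM2r a0); have : 0 <= a - q by rewrite subr_ge0.
nra.
Qed.

(** * Finite subcovers indexed by points *)

Lemma compact_finite_subcover {T : topologicalType} (K : set T)
    (P : T -> T -> Prop) : compact K ->
  (forall y, K y -> \forall x \near y, K x -> P y x) ->
  exists2 s : seq T, {subset s <= K} &
    forall x, K x -> exists2 y, y \in s & P y x.
Proof.
move=> /compact_near_coveringP/near_covering_withinP cK KP.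
(* Finite sequences of points of [K], directed by inclusion: each point is covered, locally
   uniformly, by all large enough sequences, and near-covering compactness makes one sequence serve
   all of [K]. *)
pose F := filter_from [set s : seq T | {subset s <= K}]
  (fun s => [set t : seq T | {subset s <= t}]).
have FF : Filter F.
  apply: filter_from_filter => [|s t sK tK]; first by exists [::].
  exists (s ++ t) => [x|u /= stu]; first by rewrite mem_cat => /orP[/sK|/tK].
  by split => x xs; apply: stu; rewrite mem_cat xs ?orbT.
have [|s sK Ks] := cK _ F (fun s x => exists2 y, y \in s & P y x) FF.
  move=> y Ky; exists ([set x | K x -> P y x], [set s : seq T | y \in s]).
    split; [exact: KP|exists [:: y]] => [z|s /=].
      by rewrite inE => /eqP ->; rewrite inE.
    by apply; rewrite inE.
  by move=> [x s] /= [KPx ys] Kx; exists y => //; exact: KPx.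
by exists s => //; exact: Ks.
Qed.

(** * The Stone-Weierstrass theorem for a point-separating algebra [A] on a compact set *)

Section StoneWeierstrass.
Context {R : realType} {T : topologicalType}.
Variables (K : set T) (A : set (T -> R)).
Hypothesis cptK : compact K.
Hypothesis A_cst : forall c, A (fun=> c).
Hypothesis A_add : forall u v, A u -> A v -> A (fun x => u x + v x).
Hypothesis A_mul : forall u v, A u -> A v -> A (fun x => u x * v x).
Hypothesis A_cont : forall u, A u -> {within K, continuous u}.
Hypothesis A_sep : forall x y, K x -> K y -> x != y ->
  exists2 u, A u & u x != u y.

Definition uniformly_approximable (u : T -> R) :=
  forall e : R, 0 < e ->
    exists2 p, A p & forall x, K x -> `|u x - p x| <= e.

Lemma compact_continuous_bounded (u : T -> R) : {within K, continuous u} ->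
  exists2 M : R, 0 < M & forall x, K x -> `|u x| <= M.
Proof.
move=> cu; have /compact_bounded[M [_ uM]] := continuous_compact cu cptK.
have M1 : M < `|M| + 1 by rewrite (le_lt_trans (ler_norm M))// ltrDl.
exists (`|M| + 1) => [|x Kx]; first by rewrite ltr_wpDl.
by apply: (uM _ M1); exists x.
Qed.

(** Dividing by a bound [M] of [|u|] on [K] brings the values into [[-1, 1]], where [abs_iter]
    converges uniformly; multiplying back scales the error by [M]. *)
Lemma abs_approximable u : A u -> uniformly_approximable (fun x => `|u x|).
Proof.
move=> Au e e0; have [M M0 uM] := compact_continuous_bounded (A_cont Au).
have Ait k : A (fun x => M * abs_iter k (M^-1 * u x)).
  suff Aq : A (fun x => abs_iter k (M^-1 * u x)) by exact: A_mul.
  elim: k => [|k IH] /=; first exact: A_cst.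
  have Au1 : A (fun x => M^-1 * u x) by exact: A_mul.
  by do ?[exact: A_cst | exact: IH | exact: Au1 | apply: A_add | apply: A_mul].
have [k ke] : exists k, M * (2 / k.+1%:R) <= e.
  exists (Num.truncn (e^-1 * (M * 2))).
  rewrite mulrA ler_pdivrMr ?ltr0n// -ler_pdivrMl// ltW//.
  exact: truncnS_gt.
exists (fun x => M * abs_iter k.+1 (M^-1 * u x)) => // x Kx.
have /(abs_iter_error k) : `|M^-1 * u x| <= 1.
  by rewrite normrM gtr0_norm ?invr_gt0// ler_pdivrMl// mulr1 uM.
set q := abs_iter _ _ => H; apply: le_trans ke.
have -> : `|u x| - M * q = M * (`|M^-1 * u x| - q).
  by rewrite normrM gtr0_norm ?invr_gt0// mulrBr mulrA divff ?mul1r// gt_eqF.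
by rewrite normrM (gtr0_norm M0) ler_pM2l.
Qed.

(** This rests on [min a b = (a + b - |a - b|) / 2]. Only [u] is a limit while [v] lies in [A],
    which suffices for minima built up one function at a time. *)
Lemma min_approximable u v : uniformly_approximable u -> A v ->
  uniformly_approximable (fun x => Num.min (u x) (v x)).
Proof.
move=> apu Av e e0; have e2 : 0 < e / 2 by rewrite divr_gt0.
have [p Ap up] := apu _ e2.
have Apv : A (fun x => p x + (-1) * v x).
  by do ?apply: A_add; rewrite //; exact: A_mul.
have [q Aq pvq] := abs_approximable Apv e2.
exists (fun x => 2^-1 * (p x + v x + (-1) * q x)).
  by apply: A_mul => //; do ?apply: A_add; rewrite //; exact: A_mul.
move=> x /[dup] /up + /pvq; move: (u x) (v x) (p x) (q x) => a b c d.
rewrite !ler_norml => /andP[? ?] /andP[+ +].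
have [ab|ab] := lerP a b; have [cb|cb] := ler0P (c + -1 * b); lra.
Qed.

Lemma sum_closed (I : Type) (s : seq I) (g : I -> T -> R) :
  (forall i, A (g i)) -> A (fun x => \sum_(i <- s) g i x).
Proof.
move=> Ag; elim: s => [|i s IH].
  by under eq_fun do rewrite big_nil; exact: A_cst.
by under eq_fun do rewrite big_cons; exact: A_add.
Qed.

Lemma near_within_lt (u v : T -> R) y : K y -> {within K, continuous u} ->
  {within K, continuous v} -> u y < v y ->
  \forall x \near y, K x -> u x < v x.
Proof.
move=> Ky cu cv uvy.
have cuv : {within K, continuous (v - u)}.
  by move=> x; apply: cvgB; [exact: cv|exact: cu].
move/subspace_continuousP : cuv => /(_ _ Ky) /cvgrPdist_lt.
have vu0 : 0 < v y - u y by rewrite subr_gt0.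
move=> /(_ _ vu0); rewrite near_withinE /=.
apply: filterS => x + Kx => /(_ Kx); rewrite !fctE ltr_norml => /andP[_].
by rewrite /from_subspace /=; lra.
Qed.

(* Squares of functions vanishing at z, added to the constant f z + e, keep its
   value at z and raise it elsewhere; by compactness finitely many suffice. *)
Lemma majorant_touching_at (f : T -> R) (z : T) (e : R) : K z -> 0 < e ->
  {within K, continuous f} ->
  exists h, [/\ A h, h z = f z + e & forall x, K x -> f x < h x].
Proof.
move=> Kz e0 cf.
have /choice[g gP] y : exists g, [/\ A g, g z = 0, forall x, 0 <= g x &
    K y -> f y < f z + e + g y].
  have [fyz|fyz] := ltP (f y) (f z + e).
    by exists (fun=> 0); split => // _; rewrite addr0.
  have [Ky|nKy] := pselect (K y); last by exists (fun=> 0); split.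
  have zy : z != y by apply/eqP => zy; move: fyz; rewrite zy leNgt ltrDl e0.
  have [u Au uzy] := A_sep Kz Ky zy.
  pose d x := u x + (-1) * u z.
  have Ad : A d by apply: A_add => //; exact: A_mul.
  have dy : 0 < d y * d y.
    by rewrite -expr2 exprn_even_gt0//= /d mulN1r subr_eq0 eq_sym.
  (* With this scaling the multiple of the square takes the value [f y - f z] at [y], so that adding
     [f z + e] exceeds [f y] by exactly [e]. *)
  pose c := (f y - f z) / (d y * d y).
  have fyz0 : 0 <= f y - f z by rewrite subr_ge0 (le_trans _ fyz)// lerDl ltW.
  exists (fun x => c * (d x * d x)); split.
  - by apply: A_mul => //; exact: A_mul.
  - by rewrite /d mulN1r subrr !mulr0.
  - by move=> x; rewrite mulr_ge0 ?divr_ge0 ?(ltW dy)// -expr2 sqr_ge0.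
  - by move=> _; rewrite /c divfK ?gt_eqF//; lra.
have Ag y : A (g y) by have [] := gP y.
have [y Ky|s sK Ks] :=
    compact_finite_subcover (P := fun y x => f x < f z + e + g y x) cptK.
  have [_ _ _ /(_ Ky) fy] := gP y.
  by apply: near_within_lt => //; apply: A_cont; exact: A_add.
exists (fun x => f z + e + \sum_(y <- s) g y x); split.
- by apply: A_add => //; exact: sum_closed.
- by rewrite big1 ?addr0// => y _; have [] := gP y.
move=> x Kx; have [y ys fx] := Ks _ Kx.
apply: lt_le_trans fx _; rewrite lerD2l (big_rem y ys)/= lerDl.
by apply: sumr_ge0 => i _; have [] := gP i.
Qed.

(** The majorant [h z] touching [f + e / 3] at [z] stays below [f + 2 * e / 3] near [z]. By
    compactness the minimum [u] of finitely many of these lies between [f] and [f + 2 * e / 3] on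
    all of [K], and approximating [u] within [e / 3] completes the error budget. *)
Lemma stone_weierstrass (f : T -> R) :
  {within K, continuous f} -> uniformly_approximable f.
Proof.
move=> cf e e0; have e3 : 0 < e / 3 by rewrite divr_gt0.
have [[z0 Kz0]|K0] := pselect (K !=set0); last first.
  by exists (fun=> 0) => // x Kx; case: K0; exists x.
have /choice[h hP] z : exists h, K z ->
    [/\ A h, h z = f z + e / 3 & forall x, K x -> f x < h x].
  have [Kz|] := pselect (K z); last by exists f.
  by have [h hP] := majorant_touching_at Kz e3 cf; exists h.
have [z Kz|s sK Ks] :=
    compact_finite_subcover (P := fun z x => h z x < f x + e / 3 + e / 3) cptK.
  have [Ah hz _] := hP _ Kz.
  apply: (@near_within_lt (h z) (fun x => f x + e / 3 + e / 3)) => //.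
  + exact: A_cont.
  + move=> x; apply: cvgD; last exact: cvg_cst.
    by apply: cvgD; [exact: cf|exact: cvg_cst].
  + by rewrite hz ltrDl.
have [u [apu fu uh]] : exists u, [/\ uniformly_approximable u,
    forall x, K x -> f x <= u x &
    forall x z, z \in s -> u x <= h z x].
  elim: s {Ks} sK => [_|z r IH rK].
    (* An empty minimum has no real value, so the induction starts from the majorant at an arbitrary
       point of [K]; the extra function is harmless, as it too lies above [f]. *)
    exists (h z0); have [Ah _ fh] := hP _ Kz0; split => //.
    - by move=> d d0; exists (h z0) => // x _; rewrite subrr normr0 ltW.
    - by move=> x Kx; rewrite ltW ?fh.
  have [|u [apu fu uh]] := IH.
    by move=> y yr; apply: rK; rewrite inE yr orbT.
  have Kz : K z by apply/set_mem/rK; rewrite inE eqxx.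
  have [Ah _ fh] := hP _ Kz.
  exists (fun x => Num.min (u x) (h z x)); split.
  - exact: min_approximable.
  - by move=> x Kx; rewrite le_min fu// ltW ?fh.
  - move=> x y; rewrite inE => /predU1P[->|/uh yr].
      by rewrite ge_min lexx orbT.
    by rewrite ge_min yr.
have [p Ap pu] := apu _ e3; exists p => // x Kx.
have [y ys] := Ks _ Kx.
move: (pu _ Kx) (fu _ Kx) (uh x _ ys); rewrite !ler_norml => /andP[? ?] ? ? ?.
apply/andP; split; lra.
Qed.

End StoneWeierstrass.

(** * Borel measurability on closed sets *)

Lemma closed_borel_measurable {R : realType} (n0 n1 : nat)
    (D : set ('rV[R]_n1 * 'rV[R]_n0)) :
  closed D -> measurable (D : set (borelT R n0 n1)).
Proof.
move=> clD; rewrite -[D]setCK; apply: measurableC; apply: sub_sigma_algebra.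
exact: closed_openC.
Qed.

(** Open intervals generate the Borel sets of the line, and their preimages are traces on [D] of
    open sets, hence Borel because [D] is closed. *)
Lemma within_continuous_borel_measurable {R : realType} (n0 n1 : nat)
    (D : set ('rV[R]_n1 * 'rV[R]_n0)) (f : 'rV[R]_n1 * 'rV[R]_n0 -> R) :
  closed D -> {within D, continuous f} ->
  measurable_fun (D : set (borelT R n0 n1)) f.
Proof.
move=> clD /continuousP cf; have mD := closed_borel_measurable clD.
apply: (measurability _ (measurable_realfun.RGenOpens.measurableE R)).
move=> _ [_ [a [b ->] <-]].
have /open_subspaceP[V oV VD] :=
  cf _ (@interval_open R (BRight a) (BLeft b) isT isT).
rewrite setIC -VD; apply: measurableI => //.
exact: sub_sigma_algebra.
Qed.

(** * Density of polynomials in the continuous functions on a compact set of pairs *)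

Section PolynomialsOnPairs.
Context {R : realType} {m n : nat}.

Definition evalp_pair (p : mpoly (m + n) R) (z : 'rV[R]_m * 'rV[R]_n) : R :=
  evalp p (row_mx z.1 z.2).

Lemma evalp_pair_continuous p : continuous (evalp_pair p).
Proof.
have coord i : continuous (fun z : 'rV[R]_m * 'rV[R]_n => row_mx z.1 z.2 0 i).
  move=> z; under eq_fun do rewrite mxE; case: fintype.split => j.
    apply: (@continuous_comp _ _ _ fst (fun v : 'rV[R]_m => v 0 j)).
      exact: cvg_fst.
    exact: coord_continuous.
  apply: (@continuous_comp _ _ _ snd (fun v : 'rV[R]_n => v 0 j)).
    exact: cvg_snd.
  exact: coord_continuous.
have coordX i d : continuous
    (fun z : 'rV[R]_m * 'rV[R]_n => row_mx z.1 z.2 0 i ^+ d).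
  move=> z; exact: (continuous_comp (coord i z) (@exprn_continuous R d _)).
rewrite /evalp_pair /evalp; under eq_fun do rewrite mevalE.
apply: continuous_big => [|k _]; first exact: add_continuous.
move=> z; apply: cvgM; first exact: cvg_cst.
by apply: cvg_big => [|i _]; [exact: mul_continuous|exact: coordX].
Qed.

(** The coordinate polynomials suffice: if every one of them agrees at two points, the points
    coincide. *)
Lemma evalp_pair_separates z z' : z != z' ->
  exists p, evalp_pair p z != evalp_pair p z'.
Proof.
move=> zz'; apply/not_existsP => H; case/eqP: zz'.
have : row_mx z.1 z.2 = row_mx z'.1 z'.2.
  apply/rowP => k; have /negP/negPn/eqP := H (mpolyX R (mnm1 k)).
  by rewrite /evalp_pair /evalp !mevalXU.
by case: z z' {H} => [? ?] [? ?] /eq_row_mx[/= -> ->].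
Qed.

Lemma polynomials_dense (K : set ('rV[R]_m * 'rV[R]_n))
    (f : 'rV[R]_m * 'rV[R]_n -> R) (e : R) :
  compact K -> {within K, continuous f} -> 0 < e ->
  exists p, forall z, K z -> `|f z - evalp_pair p z| <= e.
Proof.
move=> cK cf e0.
have [|||||_ [p _ <-] pe] :=
  @stone_weierstrass _ _ K (range evalp_pair) cK _ _ _ _ _ f cf e e0.
- move=> c; exists (mpolyC _ c) => //.
  by apply/funext => z; rewrite /evalp_pair /evalp mevalC.
- move=> _ _ [p _ <-] [q _ <-]; exists (p + q) => //.
  by apply/funext => z; rewrite /evalp_pair /evalp mevalD.
- move=> _ _ [p _ <-] [q _ <-]; exists (p * q) => //.
  by apply/funext => z; rewrite /evalp_pair /evalp mevalM.
- move=> _ [p _ <-]; apply: continuous_subspaceT; exact: evalp_pair_continuous.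
- move=> z z' _ _ /evalp_pair_separates[p pz]; exists (evalp_pair p) => //.
by exists p.
Qed.

End PolynomialsOnPairs.

(** * The value of the polynomial optimization problem *)

Local Open Scope ereal_scope.

Theorem theorem2p2 (R : realType) (n0 n1 n2 : nat) (I0 I1 I2 : finType)
    (g0 : I0 -> mpoly n0 R) (g1 : I1 -> mpoly n1 R)
    (g2 : I2 -> mpoly (n1 + n2 + n0) R) (F : mpoly (n1 + n2 + n0) R)
    (nu : probability (borelT R n0 n1) R)
    (cptF : compact (feasF g0 g1 g2))
    (f2_fin : forall z, feasF g0 g1 g2 z -> recourse g2 F z \is a fin_num)
    (f2_cont : {within feasF g0 g1 g2, continuous (recourse g2 F)})
    (nu_supp : nu (~` feasF g0 g1 g2) = 0) :
  (exists M : R, forall p, feasible g0 g1 g2 F p ->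
     objective g0 g1 g2 nu p <= M%:E) /\
  ereal_sup [set objective g0 g1 g2 nu p | p in feasible g0 g1 g2 F] =
    \int[nu]_(z in feasF g0 g1 g2) recourse g2 F z.
Proof.
set D := feasF g0 g1 g2 in cptF f2_fin f2_cont nu_supp *.
(* Off [D] the recourse may be infinite, and [fine] then returns 0; the integrals over [D] never see
   this value. *)
pose f z := fine (recourse g2 F z).
have clD : closed D by exact: compact_closed (@norm_hausdorff _ _) cptF.
have mD := closed_borel_measurable clD.
(* Continuity on the compact set [D] gives boundedness, and a bounded measurable function is
   integrable for a finite measure. *)
have integrable_cont (h : 'rV[R]_n1 * 'rV[R]_n0 -> R) :
    {within D, continuous h} -> nu.-integrable D (EFin \o h).
  move=> ch; apply: measurable_bounded_integrable => //.
  - by rewrite (le_lt_trans (probability_le1 _ _))// ltry.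
  - exact: within_continuous_borel_measurable.
  - have [M _ hM] := compact_continuous_bounded cptF ch.
    exists M; split; first by rewrite num_real.
    by move=> M' MM' z Dz /=; rewrite (le_trans (hM _ Dz))// ltW.
have cf : {within D, continuous f}.
  apply/subspace_continuousP => z Dz; apply: fine_cvg; rewrite fineK ?f2_fin//.
  by move/subspace_continuousP: f2_cont => /(_ _ Dz).
have feasibleP p : feasible g0 g1 g2 F p <->
    forall z, D z -> (evalp_pair p z <= f z)%R.
  split=> [pF z Dz|pf w [Dw Yw]].
    rewrite -lee_fin fineK ?f2_fin//; apply: le_ereal_inf_tmp => _ [y Yy <-].
    rewrite lee_fin -subr_ge0; have := pF (z.1, y, z.2).
    rewrite /evalp mevalB -/(evalp _ _) -/(evalp _ _) evalp_embed_xxi; apply.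
    by split => //=; case: z Dz Yy.
  rewrite /evalp mevalB -/(evalp _ _) -/(evalp _ _) evalp_embed_xxi subr_ge0.
  rewrite -lee_fin (@le_trans _ _ (recourse g2 F (w.1.1, w.2)))//.
    by rewrite -[leRHS]fineK ?f2_fin// lee_fin; exact: (pf (w.1.1, w.2)).
  by apply: ereal_inf_lbound; exists w.1.2.
have If := integrable_cont _ cf.
have Ip p : nu.-integrable D (EFin \o evalp_pair p).
  apply: integrable_cont; apply: continuous_subspaceT.
  exact: evalp_pair_continuous.
have -> : \int[nu]_(z in D) recourse g2 F z = \int[nu]_(z in D) (f z)%:E.
  by apply: eq_integral => z /set_mem Dz; rewrite fineK ?f2_fin.
have upper p : feasible g0 g1 g2 F p ->
    objective g0 g1 g2 nu p <= \int[nu]_(z in D) (f z)%:E.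
  move=> /feasibleP pf; apply: (le_integral mD (Ip p) If) => z /set_mem Dz.
  by rewrite lee_fin pf.
split.
  exists (fine (\int[nu]_(z in D) (f z)%:E)) => p /upper.
  by rewrite fineK// integrable_fin_num.
apply/eqP; rewrite eq_le; apply/andP; split.
  by apply: ge_ereal_sup => _ [p /upper ? <-].
apply/lee_addgt0Pr => e e0.
have cfe : {within D, continuous (fun z => f z - e / 2)%R}.
  by move=> z; apply: cvgB; [exact: cf|exact: cvg_cst].
have e2 : (0 < e / 2)%R by rewrite divr_gt0.
have [p pf] := polynomials_dense cptF cfe e2.
(* The shift by [e / 2] absorbs the upper error, which gives feasibility, and adds to the lower
   error, for a total loss of [e]. *)
have {}pf z : D z -> (evalp_pair p z <= f z <= evalp_pair p z + e)%R.
  by move=> /pf; rewrite ler_norml => /andP[? ?]; apply/andP; split; lra.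
have pF : feasible g0 g1 g2 F p by apply/feasibleP => z /pf /andP[].
apply: (@le_trans _ _ (objective g0 g1 g2 nu p + e%:E)); last first.
  by rewrite leeD2r//; apply: ereal_sup_ubound; exists p.
have Ie : nu.-integrable D (EFin \o cst e).
  by apply: integrable_cont => z; exact: cvg_cst.
apply: (@le_trans _ _ (\int[nu]_(z in D) ((evalp_pair p z)%:E + e%:E))).
  apply: le_integral => //; first exact: (integrableD mD (Ip p) Ie).
  by move=> z /set_mem /pf /andP[_]; rewrite -EFinD lee_fin.
rewrite (integralD mD (Ip p) Ie) leeD2l// (integral_cst nu mD e%:E).
(* The constant [e] integrates to [e] times the mass of [D], which is at most 1. *)
rewrite -[leRHS]mule1; apply: lee_wpmul2l; first by rewrite lee_fin ltW.
exact: probability_le1.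
Qed.
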